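(* Let $S^2=\{\mathbf{x}\in\mathbb{R}^3: |\mathbf{x}|=r\}$ with $r>0$, let $\star$ be the product of functions on $S^2$ obtained by restriction from $\mathbb{R}^3\setminus\{\mathbf 0\}$ of $$f\star g = fg+\sum_{n=1}^{\infty}C_n\!\left(\tfrac{\hbar}{r}\right)J^{a_1b_1}\cdots J^{a_nb_n}\,\partial_{a_1}\cdots\partial_{a_n}f\;\partial_{b_1}\cdots\partial_{b_n}g ,$$ and let $\diamond$ be the product of functions on $S^2=\mathrm{SU}(2)/\mathrm{U}(1)$ defined, in terms of lifts to $\mathrm{SU}(2)$, by $$f\diamond g = fg+\sum_{n=1}^{\infty}C_n\!\left(\tfrac{\hbar}{r}\right)L_-^n f\; L_+^n g ,$$ where $C_n$, $J^{ab}$, $L_\pm$ are as defined in the context. Then $$f\diamond g=f\star g\qquad\text{for all } f,g\in C^\infty(S^2).$$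
   Context: $\hbar$ is a formal parameter; functions are complex valued, products take values in $C^\infty(S^2)[[\hbar]]$, and repeated indices $a,b,c\in\{1,2,3\}$ are summed. Coefficients: $C_n(h)=\dfrac{h^n}{n!\,(1-h)(1-2h)\cdots(1-(n-1)h)}$ for $n\ge1$, with $h=\hbar/r$, expanded as a formal power series. The product $\star$: $J^{ab}=r^2\delta_{ab}-x_ax_b+ir\,\epsilon_{abc}x_c$ with $r=|\mathbf x|$, $\epsilon_{abc}$ the Levi-Civita symbol, $\partial_a=\partial/\partial x_a$. It is defined for functions on $\mathbb{R}^3\setminus\{\mathbf 0\}$. It satisfies $\phi(r^2)\star g=g\star\phi(r^2)=\phi(r^2)g$, and restricts to the sphere: for $f,g\in C^\infty(S^2)$, extend them to smooth functions on $\mathbb{R}^3\setminus\{\mathbf 0\}$, apply $\star$, and restrict to $|\mathbf x|=r$; the result does not depend on the extensions. The product $\diamond$: for $X\in\mathfrak{su}(2)$, the left invariant vector field acts on $f\in C^\infty(\mathrm{SU}(2))$ by $X(f)(a)=\frac{d}{dt}f(a\exp(tX))|_{t=0}$; for $Z=X+iY\in\mathfrak{sl}(2,\mathbb{C})$ with $X,Y\in\mathfrak{su}(2)$, $Z(f)=X(f)+iY(f)$. Let $L_1,L_2,L_3$ be a basis of $\mathfrak{su}(2)$ with $[L_a,L_b]=-\epsilon_{abc}L_c$, and $L_\pm=L_1\pm iL_2$. The subgroup $\mathrm{U}(1)$ is the one generated by $L_3$. $\mathrm{SU}(2)$ acts on $\mathbb{R}^3$ through the double cover $\mathrm{SU}(2)\to\mathrm{SO}(3)$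 whose differential sends $L_a$ to the linear map $\mathbf{x}\mapsto \mathbf{x}\times\mathbf{e}_a$, and $\mathrm{SU}(2)/\mathrm{U}(1)$ is identified with $S^2$ by $a\,\mathrm{U}(1)\mapsto a\cdot(0,0,r)$. A function $f$ on $S^2$ is lifted to the function $a\mapsto f(a\cdot(0,0,r))$ on $\mathrm{SU}(2)$; lifts are exactly the functions with $f(ah)=f(a)$ for all $h\in\mathrm{U}(1)$. For lifts $f,g$, the function $L_-^nf\,L_+^ng$ is again right $\mathrm{U}(1)$-invariant, so $\diamond$ is well defined on functions on $S^2$ (the same symbol is used for a function and its lift). *)

(* Defs.v *)
(* MathComp-Analysis, over an arbitrary R : realType; complex numbers are R[i]. *)
From HB Require Import structures.
From mathcomp Require Import all_boot all_order all_algebra.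
From mathcomp Require Import complex spectral.
From mathcomp Require Import all_classical all_reals all_analysis.

Set Implicit Arguments.
Unset Strict Implicit.
Unset Printing Implicit Defensive.

Import Order.TTheory GRing.Theory Num.Theory numFieldNormedType.Exports.
Local Open Scope classical_set_scope.
Local Open Scope ring_scope.
Local Open Scope complex_scope.
Local Open Scope sesquilinear_scope.

(* The usual topology of R[i], hence of the complex matrices 'M[R[i]]_2. *)
HB.instance Definition _ (R : realType) :=
  NormedModule.copy (complex R) ((complex R : numFieldType)^o).

Section FormalPowerSeries.
Variable K : fieldType.
Implicit Types u v : nat -> K.

(* A formal power series in one parameter is its sequence of coefficients. *)
Definition fps_mul u v : nat -> K := fun k => \sum_(j < k.+1) u j * v (k - j)%N.

Definition fps_poly (p : {poly K}) : nat -> K := fun k => p`_k.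

Fixpoint fps_inv_seq u (k : nat) : seq K :=
  if k is k'.+1 then
    let s := fps_inv_seq u k' in
    rcons s (- (u 0%N)^-1 * \sum_(j < k'.+1) u j.+1 * s`_(k' - j))
  else [:: (u 0%N)^-1].

(* The multiplicative inverse of a series u with u 0 != 0: see fps_mulV. *)
Definition fps_inv u : nat -> K := fun k => (fps_inv_seq u k)`_k.

(* The substitution h := c * hbar. *)
Definition fps_scale (c : K) u : nat -> K := fun k => u k * c ^+ k.

Definition coefC_num (n : nat) : {poly K} := 'X^n.

Definition coefC_den (n : nat) : {poly K} :=
  n`!%:R * \prod_(1 <= j < n) (1 - j%:R * 'X).

(* C_n(h) = h^n / (n! (1 - h) (1 - 2h) ... (1 - (n-1)h)) as a series in h. *)
Definition coefC (n : nat) : nat -> K :=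
  fps_mul (fps_poly (coefC_num n)) (fps_inv (fps_poly (coefC_den n))).

Lemma size_fps_inv_seq u k : size (fps_inv_seq u k) = k.+1.
Proof. by elim: k => //= k IHk; rewrite size_rcons IHk. Qed.

Lemma nth_fps_inv_seq u k j : (j <= k)%N -> (fps_inv_seq u k)`_j = fps_inv u j.
Proof.
elim: k => [|k IHk]; first by rewrite leqn0 => /eqP ->.
rewrite leq_eqVlt => /orP [/eqP -> //|]; rewrite ltnS => jk /=.
by rewrite nth_rcons size_fps_inv_seq ltnS jk IHk.
Qed.

Lemma fps_invS u k : fps_inv u k.+1 =
  - (u 0%N)^-1 * \sum_(j < k.+1) u j.+1 * fps_inv u (k - j)%N.
Proof.
rewrite {1}/fps_inv /= nth_rcons size_fps_inv_seq ltnn eqxx; congr (_ * _).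
by apply: eq_bigr => j _; rewrite nth_fps_inv_seq // leq_subr.
Qed.

Lemma fps_mulV u k : u 0%N != 0 -> fps_mul u (fps_inv u) k = (k == 0%N)%:R.
Proof.
move=> u0; rewrite /fps_mul; case: k => [|k].
  by rewrite big_ord_recl big_ord0 addr0 /fps_inv /= divff.
rewrite big_ord_recl /= subn0 fps_invS mulrA mulrN divff // mulN1r.
by under [X in _ + X]eq_bigr => j _ do rewrite subSS; rewrite addNr.
Qed.

Lemma coefC_order n k : (k < n)%N -> coefC n k = 0.
Proof.
move=> kn; rewrite /coefC /fps_mul big1 // => j _.
rewrite /fps_poly coefXn (_ : (_ == _) = false) ?mul0r //.
by apply/negbTE; rewrite neq_ltn (leq_ltn_trans _ kn) // -ltnS.
Qed.

Lemma coefC_den0 n : fps_poly (coefC_den n) 0%N = n`!%:R.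
Proof.
rewrite /fps_poly /coefC_den -horner_coef0 hornerM horner_prod.
rewrite big1 ?mulr1 => [|j _]; first by rewrite -polyC_natr hornerC.
by rewrite -polyC_natr hornerD hornerN hornerM hornerX mulr0 subr0 hornerC.
Qed.

End FormalPowerSeries.

(* epsilon_abc, with indices 0, 1, 2. *)
Definition levi_civita (K : pzRingType) (a b c : 'I_3) : K :=
  if (b == ordS a) && (c == ordS b) then 1
  else if (b == ord_pred a) && (c == ord_pred b) then -1
  else 0.

Section Star.
Variable R : realType.
Implicit Types (x y : 'cV[R]_3) (f g : 'cV[R]_3 -> R[i]) (a b c : 'I_3).

Definition basis_vec a : 'cV[R]_3 := delta_mx a 0.

(* The library norm of 'cV[R]_3 is the sup norm. *)
Definition enorm x : R := Num.sqrt (\sum_a x a 0 ^+ 2).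

Definition sphere (r : R) : set 'cV[R]_3 := [set x | enorm x = r].

Definition partial a f : 'cV[R]_3 -> R[i] := fun x =>
  'D_(basis_vec a) (fun y => complex.Re (f y)) x +i*
  'D_(basis_vec a) (fun y => complex.Im (f y)) x.

Definition partials (s : seq 'I_3) f : 'cV[R]_3 -> R[i] := foldr partial f s.

(* Infinite differentiability on an open set U. *)
Definition smooth_on (U : set 'cV[R]_3) f : Prop :=
  forall (s : seq 'I_3) x, U x ->
    differentiable (fun y => complex.Re (partials s f y)) x /\
    differentiable (fun y => complex.Im (partials s f y)) x.

(* f is in C^oo(S^2): functions on the sphere are represented by functions on
   R^3 of which only the values on the sphere are relevant. *)
Definition smooth_sphere (r : R) f : Prop :=
  forall p, sphere r p -> exists (U : set 'cV[R]_3) (F : 'cV[R]_3 -> R[i]),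
    [/\ open U, U p, smooth_on U F &
        forall x, U x -> sphere r x -> F x = f x].

Definition punctured_space : set 'cV[R]_3 := [set x | x != 0].

Definition Jtensor x a b : R[i] :=
  (enorm x ^+ 2 * (a == b)%:R - x a 0 * x b 0) +i*
  (enorm x * \sum_c levi_civita R a b c * x c 0).

(* J^{a_1 b_1} ... J^{a_n b_n} d_{a_1} ... d_{a_n} f  d_{b_1} ... d_{b_n} g *)
Definition star_term (n : nat) f g : 'cV[R]_3 -> R[i] := fun x =>
  \sum_(a : n.-tuple 'I_3) \sum_(b : n.-tuple 'I_3)
    (\prod_(j < n) Jtensor x (tnth a j) (tnth b j))
    * partials a f x * partials b g x.

(* The coefficient of hbar ^ k in
     b_0 + \sum_(n >= 1) C_n(hbar / r) b_n;
   the terms with n > k do not contribute, by coefC_order. *)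
Definition hbar_series (r : R) (b : nat -> R[i]) : nat -> R[i] := fun k =>
  (k == 0%N)%:R * b 0%N +
  \sum_(1 <= n < k.+1) fps_scale (r^-1)%:C (coefC (R[i]) n) k * b n.

(* The product on R^3 minus the origin; star f g k is the coefficient of
   hbar ^ k. *)
Definition star f g : nat -> 'cV[R]_3 -> R[i] := fun k x =>
  hbar_series (enorm x)
    (fun n => if n is 0 then f x * g x else star_term n f g x) k.

(* Some smooth extension to R^3 minus the origin of a function on the sphere. *)
Definition extension (r : R) f : 'cV[R]_3 -> R[i] :=
  xget (cst 0) [set F | smooth_on punctured_space F /\
                        forall x, sphere r x -> F x = f x].

Definition star_sphere (r : R) f g : nat -> 'cV[R]_3 -> R[i] :=
  star (extension r f) (extension r g).

End Star.

Section Diamond.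
Variable R : realType.
Local Notation C := R[i].
Implicit Types (X Y : 'M[C]_2) (F G : 'M[C]_2 -> C) (f g : 'cV[R]_3 -> C).
Implicit Types (L : 'I_3 -> 'M[C]_2) (rho : 'M[C]_2 -> 'M[R]_3).

Definition SU2 : set 'M[C]_2 := [set a | a \is unitarymx /\ \det a = 1].

Definition su2 : set 'M[C]_2 := [set X | X ^t* = - X /\ \tr X = 0].

Definition SO3 : set 'M[R]_3 := [set A | A *m A^T = 1%:M /\ \det A = 1].

Definition expmx X : 'M[C]_2 := limn (series (fun k => k`!%:R^-1 *: X ^+ k)).

(* The vector field of X in su(2). Functions on SU(2) are represented by
   functions on matrices of which only the values on SU(2) are relevant. *)
Definition left_inv X F : 'M[C]_2 -> C := fun a =>
  derive1 (fun t : R => complex.Re (F (a *m expmx (t%:C *: X)))) 0 +i*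
  derive1 (fun t : R => complex.Im (F (a *m expmx (t%:C *: X)))) 0.

(* The vector field of X + iY in sl(2, C), for X and Y in su(2). *)
Definition left_invC X Y F : 'M[C]_2 -> C := fun a =>
  left_inv X F a + (0 +i* 1) * left_inv Y F a.

Definition Lplus L : ('M[C]_2 -> C) -> 'M[C]_2 -> C := left_invC (L 0) (L 1).

Definition Lminus L : ('M[C]_2 -> C) -> 'M[C]_2 -> C := left_invC (L 0) (- L 1).

(* A basis of su(2), over the reals, with [L_a, L_b] = - epsilon_abc L_c. *)
Definition su2_basis L : Prop :=
  [/\ forall a, su2 (L a),
      forall X, su2 X -> exists! c : 'rV[R]_3, X = \sum_a (c 0 a)%:C *: L a &
      forall a b, L a *m L b - L b *m L a =
                  - \sum_c levi_civita C a b c *: L c].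

Definition double_cover rho : Prop :=
  [/\ {within SU2, continuous rho} /\
      (forall a, SU2 a -> SO3 (rho a)),
      forall a b, SU2 a -> SU2 b -> rho (a *m b) = rho a *m rho b,
      forall A, SO3 A -> exists2 a, SU2 a & rho a = A &
      forall a, SU2 a -> rho a = 1%:M <-> a = 1%:M \/ a = - 1%:M].

Definition cross (x y : 'cV[R]_3) : 'cV[R]_3 :=
  \col_c \sum_a \sum_b levi_civita R a b c * x a 0 * y b 0.

(* The differential of rho at the identity sends L_a to x |-> x * e_a. *)
Definition differential_cross L rho : Prop :=
  forall (a : 'I_3) (x : 'cV[R]_3),
    is_derive (0 : R) (1 : R) (fun t : R => rho (expmx (t%:C *: L a)) *m x)
      (cross x (basis_vec R a)).

(* The image in S^2 = SU(2)/U(1) of the coset a U(1); U(1) is generated by L_3,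
   whose index is 2 : 'I_3. *)
Definition orbit_map (r : R) rho (a : 'M[C]_2) : 'cV[R]_3 :=
  rho a *m (r *: basis_vec R 2).

Definition lift (r : R) rho f : 'M[C]_2 -> C := fun a => f (orbit_map r rho a).

(* The product of two lifts, as a function on SU(2). *)
Definition diamond_lift (r : R) L F G : nat -> 'M[C]_2 -> C := fun k a =>
  hbar_series r (fun n => if n is 0 then F a * G a
                          else iter n (Lminus L) F a * iter n (Lplus L) G a) k.

(* The function on the sphere whose lift is the right U(1)-invariant F. *)
Definition descend (r : R) rho F : 'cV[R]_3 -> C := fun x =>
  F (xget 1%:M [set a | SU2 a /\ orbit_map r rho a = x]).

Definition diamond (r : R) L rho f g : nat -> 'cV[R]_3 -> C := fun k =>
  descend r rho (diamond_lift r L (lift r rho f) (lift r rho g) k).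

End Diamond.

(* Main.v *)
(* Let e_1, e_2, e_3 be the standard basis. On lifts, L_+ and L_- are the
   derivatives along v_+ = -i r rho(a)(e_1 + i e_2) and its conjugate v_-, and
   the entries of v_+ are killed by L_+, those of v_- by L_-, because
   (e_1 + i e_2) x (e_1 + i e_2) = 0. Hence L_+^n g is the full contraction of
   the n-th derivative of g with v_+, without lower order terms, and likewise
   for L_-^n f and v_-. Since J^{ab} = (v_-)_a (v_+)_b on the sphere, the two
   products agree term by term.
   Two facts make this usable: exp maps su(2) into SU(2), as t Y with Y^2 = -1
   has exponential cos t + Y sin t; and f(r x / |x|) is a smooth extension of f. *)
Require Import Defs.
From mathcomp Require Import all_boot all_order all_algebra.
From mathcomp Require Import complex spectral.
From mathcomp Require Import ring lra.
From mathcomp Require Import all_classical all_reals all_analysis.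
Set Implicit Arguments.
Unset Strict Implicit.
Unset Printing Implicit Defensive.
Import Order.TTheory GRing.Theory Num.Theory numFieldNormedType.Exports.
Local Open Scope classical_set_scope.
Local Open Scope ring_scope.
Local Open Scope complex_scope.
Local Open Scope sesquilinear_scope.

(** * Matrices of size 2 and 3 *)

Lemma ord2_ind (P : 'I_2 -> Prop) : P 0 -> P 1 -> forall i, P i.
Proof.
move=> P0 P1 [[|[|//]] i2].
- by rewrite (_ : Ordinal i2 = 0) //; apply: val_inj.
- by rewrite (_ : Ordinal i2 = 1) //; apply: val_inj.
Qed.

Lemma ord3_ind (P : 'I_3 -> Prop) : P 0 -> P 1 -> P 2 -> forall i, P i.
Proof.
move=> P0 P1 P2 [[|[|[|//]]] i3].
- by rewrite (_ : Ordinal i3 = 0) //; apply: val_inj.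
- by rewrite (_ : Ordinal i3 = 1) //; apply: val_inj.
- by rewrite (_ : Ordinal i3 = 2) //; apply: val_inj.
Qed.

Lemma sum2E (V : nmodType) (F : 'I_2 -> V) : \sum_i F i = F 0 + F 1.
Proof.
rewrite !big_ord_recl big_ord0 addr0.
by congr (_ + F _); apply: val_inj.
Qed.

Lemma sum3E (V : nmodType) (F : 'I_3 -> V) : \sum_i F i = F 0 + F 1 + F 2.
Proof.
rewrite !big_ord_recl big_ord0 addr0 addrA.
by congr (_ + F _ + F _); apply: val_inj.
Qed.

Lemma det_mx2 (K : comPzRingType) (A : 'M[K]_2) :
  \det A = A 0 0 * A 1 1 - A 0 1 * A 1 0.
Proof.
rewrite (expand_det_row _ 0) sum2E /cofactor !det_mx11 !mxE /=.
rewrite (_ : lift 0 0 = 1); last exact: val_inj.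
rewrite (_ : lift 1 0 = 0); last exact: val_inj.
by rewrite expr0 expr1 mul1r mulN1r mulrN.
Qed.

Lemma sqr_traceless_mx2 (K : comPzRingType) (A : 'M[K]_2) :
  \tr A = 0 -> A *m A = - \det A *: 1%:M.
Proof.
rewrite /mxtrace sum2E addrC => /eqP; rewrite addr_eq0 => /eqP A11.
apply/matrixP; elim/ord2_ind; elim/ord2_ind;
  rewrite !mxE sum2E det_mx2 A11 /=; ring.
Qed.

Lemma lift3E : ((lift 0 0 = 1 :> 'I_3) * (lift 0 1 = 2 :> 'I_3) *
  (lift 1 0 = 0 :> 'I_3) * (lift 1 1 = 2 :> 'I_3) *
  (lift 2 0 = 0 :> 'I_3) * (lift 2 1 = 1 :> 'I_3))%type.
Proof. by do !split; apply: val_inj. Qed.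

Lemma det_mx3 (K : comPzRingType) (A : 'M[K]_3) :
  \det A = A 0 0 * (A 1 1 * A 2 2 - A 1 2 * A 2 1)
         - A 0 1 * (A 1 0 * A 2 2 - A 1 2 * A 2 0)
         + A 0 2 * (A 1 0 * A 2 1 - A 1 1 * A 2 0).
Proof.
rewrite (expand_det_row _ 0) sum3E /cofactor !det_mx2 !mxE !lift3E /=.
ring.
Qed.

(** * The exponential of su(2) *)

Section Exponential.
Variable R : realType.
Local Notation C := R[i].

(** Tracelessness gives X^2 = -det X, and antihermiticity makes det X a sum of squared moduli, whose
    square root is the scale t. *)
Lemma su2_normalize (X : 'M[C]_2) : su2 X ->
  exists (t : R) (Y : 'M[C]_2), [/\ X = t%:C *: Y, su2 Y & Y *m Y = - 1%:M].
Proof.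
move=> [XH Xtr].
have XE i j : Num.conj (X j i) = - X i j.
  by have /matrixP/(_ i j) := XH; rewrite !mxE.
have X11 : X 1 1 = - X 0 0.
  by apply/eqP; rewrite -addr_eq0 addrC; move: Xtr; rewrite /mxtrace sum2E => ->.
pose c : C := `|X 0 0| ^+ 2 + `|X 0 1| ^+ 2.
have detX : \det X = c.
  rewrite det_mx2 /c !normCK !XE X11.
  by ring.
have c_ge0 : 0 <= c by rewrite addr_ge0 // exprn_ge0.
have [c0|c_neq0] := eqVneq c 0.
  have X0 : X = 0.
    move/eqP: c0; rewrite paddr_eq0 ?exprn_ge0 // !expf_eq0 /= !normr_eq0.
    case/andP=> /eqP X00 /eqP X01.
    apply/matrixP; elim/ord2_ind; elim/ord2_ind; rewrite mxE ?X11 ?X00 ?oppr0 //.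
    by rewrite -[X 1 0]opprK -XE X01 conjC0 oppr0.
  (* For X = 0 the scale is 0 and any unit element serves: here Y = diag(i, -i). *)
  pose Y : 'M[C]_2 := \matrix_(i, j) ((i == j)%:R * (-1) ^+ i * 'i).
  exists 0, Y; split.
  - by rewrite X0 scale0r.
  - split; last by rewrite /mxtrace sum2E !mxE /=; ring.
    apply/matrixP; elim/ord2_ind; elim/ord2_ind;
      by rewrite !mxE /= !rmorphM /= conjCi ?rmorph1 ?rmorphN ?rmorph0 /= ?rmorph1 ?rmorph0; ring.
  - apply/matrixP; elim/ord2_ind; elim/ord2_ind; rewrite !mxE sum2E !mxE /=.
    all: rewrite ?(mul0r, mulr0, addr0, add0r, oppr0, mul1r) //.
    + by rewrite -expr2 sqrCi.
    + by rewrite ?mulN1r ?mulrNN -expr2 sqrCi.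
pose s := Num.sqrt (complex.Re c).
have cE : c = (complex.Re c)%:C by rewrite RRe_real // ger0_real.
have Rc_gt0 : 0 < complex.Re c by rewrite -ltcR -cE lt_def c_neq0.
have s_neq0 : s != 0 by rewrite gt_eqF // sqrtr_gt0.
have sC : s%:C != 0 by rewrite eq_complex /= negb_and s_neq0.
have s2 : s%:C * s%:C = c.
  by rewrite -rmorphM -expr2 sqr_sqrtr ?ltW // -cE.
have sJ : Num.conj (s%:C^-1) = s%:C^-1 :> C.
  by rewrite conj_Creal // realV complex_real.
exists s, (s%:C^-1 *: X); split.
- by rewrite scalerA divff // scale1r.
- split; last by rewrite mxtraceZ Xtr mulr0.
  apply/matrixP => i j; rewrite !mxE -[LHS]/(Num.conj (s%:C^-1 * X j i)).
  by rewrite rmorphM /= XE sJ mulrN.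
- rewrite -scalemxAl -scalemxAr sqr_traceless_mx2 // detX !scalerA -invfM s2.
  by rewrite mulrN mulVf // scaleN1r.
Qed.

Lemma cvg_real_complex (u : nat -> R) (l : R) :
  u @ \oo --> l -> (fun n => (u n)%:C : C) @ \oo --> (l%:C : C).
Proof.
move=> ul; apply/cvgrPdist_lt => e e0.
have eE : e = (complex.Re e)%:C by rewrite RRe_real // gtr0_real.
have Re0 : 0 < complex.Re e by rewrite -ltcR -eE.
near=> n; rewrite -rmorphB /= eE normc_def /= expr0n addr0 sqrtr_sqr ltcR.
near: n; move/cvgrPdist_lt: ul; exact.
Unshelve. all: by end_near. Qed.

(** Up to sign, the powers of Y alternate between 1 and Y, so the partial sums of the exponential
    are exactly those of cosine and sine. *)
Lemma expmx_cos_sin (t : R) (Y : 'M[C]_2) : Y *m Y = - 1%:M ->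
  expmx (t%:C *: Y) = (cos t)%:C *: 1%:M + (sin t)%:C *: Y.
Proof.
move=> YY; rewrite /expmx; apply: cvg_lim => //.
have YX k : Y ^+ k = ((~~ odd k)%:R * (-1) ^+ k./2) *: 1%:M
    + ((odd k)%:R * (-1) ^+ k.-1./2) *: Y.
  elim: k => [|k IHk].
    by rewrite expr0 /= mul1r expr0 scale1r mul0r scale0r addr0.
  rewrite exprSr IHk mulrDl -!scalerAl mul1r -[Y * Y]/(Y *m Y) YY /= uphalf_half.
  case: (boolP (odd k)) => ok /=; rewrite !(mul0r, scale0r, add0r, addr0, mul1r) //.
  rewrite scalerN -scaleNr; congr (_ *: _).
  case: k ok {IHk} => // k /= ok.
  by rewrite uphalf_half (negbTE ok) /= add0n exprS mulN1r.
pose u := series (cos_coeff t); pose v := series (sin_coeff t).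
rewrite (_ : series _ = fun n => (u n)%:C *: 1%:M + (v n)%:C *: Y); last first.
  apply/funext => n; rewrite /series /= !rmorph_sum /= !scaler_suml -big_split /=.
  apply: eq_bigr => k _.
  rewrite exprZn YX scalerA scalerDr !scalerA /cos_coeff /sin_coeff.
  rewrite !rmorphM !fmorphV !rmorphXn !rmorph_nat !rmorphN1.
  by congr (_ *: _ + _ *: _); ring.
apply: cvgD; apply: cvgZr_tmp; apply: cvg_real_complex.
(* [cos t] is by definition the limit of its series, so only convergence is left. *)
- by rewrite unlock; exact: is_cvg_series_cos_coeff.
- by rewrite unlock; exact: is_cvg_series_sin_coeff.
Qed.

(** This keeps the curves a exp(tX) inside SU(2), where [rho] is multiplicative. The adjoint cos t -
    Y sin t of cos t + Y sin t is its inverse because Y^2 = -1. *)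
Lemma expmx_SU2 (X : 'M[C]_2) : su2 X -> SU2 (expmx X).
Proof.
move=> /su2_normalize [t [Y [-> [YH Ytr] YY]]]; rewrite expmx_cos_sin //.
have cs : (cos t)%:C * (cos t)%:C + (sin t)%:C * (sin t)%:C = 1 :> C.
  by rewrite -!rmorphM -rmorphD -!expr2 cos2Dsin2.
split.
- apply/unitarymxP.
  have -> : ((cos t)%:C *: 1%:M + (sin t)%:C *: Y)^t* =
      (cos t)%:C *: 1%:M - (sin t)%:C *: Y.
    rewrite linearD !linearZ /= trmx1 map_mxD !map_mxZ map_mx1.
    by rewrite -YH; congr (_ *: _ + _ *: _);
      apply: conj_Creal; rewrite complex_real.
  rewrite mulmxDl !mulmxBr -!scalemxAl -!scalemxAr !mul1mx !mulmx1 YY !scalerA.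
  rewrite (mulrC (sin t)%:C (cos t)%:C) addrA subrK scalerN opprK -scalerDl cs.
  by rewrite scale1r.
- have detY : \det Y = 1.
    have /matrixP/(_ 0 0) := sqr_traceless_mx2 Ytr.
    by rewrite YY !mxE /= mulr1 => /oppr_inj.
  have Y11 : Y 1 1 = - Y 0 0.
    by apply/eqP; rewrite -addr_eq0 addrC; move: Ytr; rewrite /mxtrace sum2E => ->.
  (* The cross term cos t sin t tr Y vanishes. *)
  transitivity ((cos t)%:C * (cos t)%:C + (sin t)%:C * (sin t)%:C * \det Y).
    by rewrite !det_mx2 !mxE /= Y11; ring.
  by rewrite detY mulr1 cs.
Qed.

End Exponential.

(** * Rotations *)

Section Rotations.
Variable R : realType.
Implicit Types (A : 'M[R]_3) (x : 'cV[R]_3).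

(** The adjugate of a rotation is its transpose, so the third column consists of its own cofactors:
    it is the cross product of the first two columns. *)
Lemma SO3_col2 A : SO3 A -> forall i j,
  A i 0 * A j 1 - A i 1 * A j 0 = \sum_c levi_civita R i j c * A c 2.
Proof.
move=> [AAT detA].
have adjA : \adj A = A^T.
  have := congr1 (mulmx (\adj A)) AAT.
  by rewrite mulmxA mul_adj_mx detA mulmx1 mul1mx.
have A2 k : A k 2 = cofactor A k 2.
  by have /matrixP/(_ 2 k) := adjA; rewrite !mxE.
elim/ord3_ind; elim/ord3_ind; rewrite sum3E /levi_civita /= ?A2 /cofactor
  ?det_mx2 ?mxE ?lift3E /=; ring.
Qed.

Lemma SO3_enorm A x : SO3 A -> enorm (A *m x) = enorm x.
Proof.
move=> [AAT _]; rewrite /enorm; congr Num.sqrt.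
have sqE (y : 'cV[R]_3) : \sum_a y a 0 ^+ 2 = (y^T *m y) 0 0.
  by rewrite mxE; apply: eq_bigr => a _; rewrite mxE expr2.
by rewrite !sqE trmx_mul -mulmxA (mulmxA A^T) (mulmx1C AAT) mul1mx.
Qed.

Lemma enorm_basis_vec (r : R) a : 0 <= r -> enorm (r *: basis_vec R a) = r.
Proof.
move=> r0; rewrite /enorm (bigD1 a) //= big1 => [|b ba]; rewrite !mxE ?eqxx /=.
  by rewrite addr0 mulr1 sqrtr_sqr ger0_norm.
by rewrite (negbTE ba) mulr0 expr0n.
Qed.

(** J has rank one on the sphere. Orthonormality of the rows turns delta_ij - A_i2 A_j2 into A_i0
    A_j0 + A_i1 A_j1, which is the real part; the imaginary part is [SO3_col2]. *)
Lemma SO3_Jtensor (r : R) A : 0 < r -> SO3 A ->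
  forall i j, Jtensor (A *m (r *: basis_vec R 2)) i j =
    ((r * A i 1) +i* (r * A i 0)) * ((r * A j 1) -i* (r * A j 0)).
Proof.
move=> r0 SA i j.
have x2 a : (A *m (r *: basis_vec R 2)) a 0 = r * A a 2.
  rewrite mxE (bigD1 2) //= big1 => [|b /negbTE b2]; last by rewrite !mxE b2 !mulr0.
  by rewrite !mxE /= mulr1 addr0 mulrC.
rewrite /Jtensor SO3_enorm // enorm_basis_vec ?ltW // !x2.
under eq_bigr => c _ do rewrite x2 mulrCA.
rewrite -mulr_sumr -SO3_col2 //.
have /matrixP/(_ i j) := SA.1; rewrite !mxE sum3E !mxE => <-.
by apply/eqP; rewrite eq_complex /=; apply/andP; split; apply/eqP; ring.
Qed.

(** It suffices to complete the unit vector y = x / r, as third column, to a positively oriented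
    orthonormal frame. *)
Lemma SO3_transitive (r : R) x : 0 < r -> sphere r x ->
  exists2 A, SO3 A & A *m (r *: basis_vec R 2) = x.
Proof.
move=> r0 xr.
pose y a := r^-1 * x a 0.
have y1 : y 0 ^+ 2 + y 1 ^+ 2 + y 2 ^+ 2 = 1.
  have : enorm x ^+ 2 = r ^+ 2 by rewrite xr.
  rewrite /enorm sqr_sqrtr ?sumr_ge0 // => [|a _]; last exact: sqr_ge0.
  rewrite sum3E /y !exprMn -!mulrDr => ->.
  by rewrite -exprMn mulVf ?expr1n // gt_eqF.
suff [A SA Ay] : exists2 A, SO3 A & forall a, A a 2 = y a.
  exists A => //; apply/matrixP => a b; rewrite ord1 mxE (bigD1 2) //= big1.
    by rewrite Ay !mxE /y /= mulr1 addr0 mulrAC mulVf ?mul1r ?gt_eqF.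
  by move=> c c2; rewrite !mxE (negbTE c2) /= !mulr0.
pose mx3 (s : seq (seq R)) : 'M[R]_3 := \matrix_(i, j) (nth [::] s i)`_j.
have [s0|s_neq0] := eqVneq (y 0 ^+ 2 + y 1 ^+ 2) 0.
  have /andP[/eqP y00 /eqP y10] : (y 0 == 0) && (y 1 == 0).
    by move/eqP: s0; rewrite paddr_eq0 ?sqr_ge0 // !sqrf_eq0.
  move: y1; rewrite s0 add0r => y2.
  (* At the poles [y 2] squares to 1, so diag(1, y 2, y 2) is a rotation. *)
  exists (mx3 [:: [:: 1; 0; 0]; [:: 0; y 2; 0]; [:: 0; 0; y 2]]).
    split; last by rewrite det_mx3 !mxE /=; move: y2; rewrite expr2; lra.
    apply/matrixP; elim/ord3_ind; elim/ord3_ind;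
      by rewrite !mxE sum3E !mxE /=; move: y2; rewrite expr2; lra.
  by elim/ord3_ind; rewrite !mxE.
pose s := Num.sqrt (y 0 ^+ 2 + y 1 ^+ 2).
have s0 : s != 0.
  by rewrite sqrtr_eq0 -ltNge lt_def s_neq0 addr_ge0 // sqr_ge0.
have s2 : s ^+ 2 = y 0 ^+ 2 + y 1 ^+ 2 by rewrite sqr_sqrtr // addr_ge0 // sqr_ge0.
have y2 : y 2 ^+ 2 = 1 - s ^+ 2 by rewrite s2; lra.
(* [p] and [q] are the cosine and sine of the longitude, [s] is the sine of the colatitude. The
   columns of the frame below are the tangent to the parallel, the tangent to the meridian and the
   radial direction. *)
pose p := y 0 / s; pose q := y 1 / s.
have pq : p ^+ 2 + q ^+ 2 = 1.
  by rewrite /p /q !expr_div_n -mulrDl -s2 divff // expf_neq0.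
have yp : y 0 = p * s by rewrite /p divfK.
have yq : y 1 = q * s by rewrite /q divfK.
exists (mx3 [:: [:: - q; - (y 2 * p); p * s]; [:: p; - (y 2 * q); q * s];
                [:: 0; s; y 2]]).
  have q2 : q ^+ 2 = 1 - p ^+ 2 by lra.
  split; last first.
    rewrite det_mx3 !mxE /=.
    transitivity ((p ^+ 2 + q ^+ 2) * (y 2 ^+ 2 + s ^+ 2)); first by ring.
    by rewrite pq y2; ring.
  apply/matrixP; elim/ord3_ind; elim/ord3_ind; rewrite !mxE sum3E !mxE /=;
    ring: q2 y2.
by elim/ord3_ind; rewrite !mxE.
Qed.

End Rotations.

(** * Smooth extension from the sphere *)

(** Differentiability depends only on the germ: g inherits the first order expansion of f, and
    uniqueness of the differential identifies 'd g with 'd f. *)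
Lemma near_eq_differentiable (K : numFieldType) (V W : normedModType K)
    (f g : V -> W) (x : V) :
  (\near x, f x = g x) -> differentiable f x -> differentiable g x.
Proof.
move=> fg df; have fgx := nbhs_singleton fg.
have gE : g \o shift x = cst (g x) + 'd f x +o_ 0 id.
  apply/eqaddoP => e e0; have /eqaddoP/(_ e e0) fE := diff_locally df.
  have fg0 : \forall h \near 0, f (h + x) = g (h + x).
    by move: fg; rewrite (near_shift 0) subr0; exact.
  by apply: filterS2 fg0 fE => h /= fgh; rewrite !fctE /= fgh fgx.
have dE : 'd g x = 'd f x :> (V -> W).
  exact: (diff_unique (diff_continuous df) gE).
by apply/diff_locallyP; rewrite dE; split => //; exact: (diff_continuous df).
Qed.

(** * Derivatives of the coordinates and of the Euclidean norm *)

Section Calculus.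
Variable R : realType.
Implicit Types (x v : 'cV[R]_3) (h : 'cV[R]_3 -> R).

Lemma derive_basis h x v : differentiable h x ->
  'D_v h x = \sum_a v a 0 * 'D_(basis_vec R a) h x.
Proof.
move=> dh; rewrite deriveE //.
have {1}-> : v = \sum_a v a 0 *: basis_vec R a.
  apply/matrixP => i j; rewrite ord1 summxE (bigD1 i) //= big1 => [|k ki].
    by rewrite !mxE !eqxx mulr1 addr0.
  by rewrite !mxE eq_sym (negbTE ki) mulr0.
rewrite linear_sum; apply: eq_bigr => a _.
by rewrite linearZ /= deriveE.
Qed.

Lemma derive_coord x v (a : 'I_3) : 'D_v (fun y : 'cV[R]_3 => y a 0) x = v a 0.
Proof.
have := @derive_mx _ _ 3 1 id x v (@derivable_id _ _ _ _).
by rewrite derive_id => /matrixP/(_ a 0); rewrite mxE.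
Qed.

Definition sqnorm x := \sum_a x a 0 ^+ 2.

Lemma sqnorm_gt0 x : x != 0 -> 0 < sqnorm x.
Proof.
move=> x0; rewrite lt_def sumr_ge0 ?andbT => [|a _]; last exact: sqr_ge0.
apply: contra_neq x0 => /eqP; rewrite psumr_eq0 => [/allP x0|a _]; last exact: sqr_ge0.
apply/matrixP => i j; rewrite ord1 mxE.
by have /(_ (mem_index_enum i)) := x0 i; rewrite sqrf_eq0 => /eqP.
Qed.

Lemma enorm_gt0 x : x != 0 -> 0 < enorm x.
Proof. by move=> x0; rewrite sqrtr_gt0 sqnorm_gt0. Qed.

Lemma differentiable_sqnorm x : differentiable sqnorm x.
Proof.
rewrite (_ : sqnorm = \sum_(a < 3) (fun y : 'cV[R]_3 => y a 0) ^+ 2).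
  by apply: differentiable_sum => a; exact/differentiableX/differentiable_coord.
by apply/funext => y; rewrite fct_sumE.
Qed.

Lemma derive_sqnorm x v : 'D_v sqnorm x = \sum_a 2 * x a 0 * v a 0.
Proof.
rewrite (_ : sqnorm = \sum_(a < 3) (fun y : 'cV[R]_3 => y a 0) ^+ 2); last first.
  by apply/funext => y; rewrite fct_sumE.
have dc a : derivable (fun y : 'cV[R]_3 => y a 0) x v.
  exact/diff_derivable/differentiable_coord.
rewrite derive_sum => [|a]; last exact: derivableX.
apply: eq_bigr => a _; rewrite deriveX // derive_coord expr1.
by rewrite /GRing.scale /=; ring.
Qed.

Lemma differentiable_sqrt (t : R) : 0 < t -> differentiable (@Num.sqrt R) t.
Proof.
by move=> t0; apply/derivable1_diffP; have [] := is_derive1_sqrt t0.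
Qed.

Lemma differentiable_enorm x : x != 0 -> differentiable (@enorm R) x.
Proof.
move=> x0; apply: (@differentiable_comp _ _ _ _ sqnorm).
  exact: differentiable_sqnorm.
exact/differentiable_sqrt/sqnorm_gt0.
Qed.

Lemma derive_enorm x v : x != 0 ->
  'D_v (@enorm R) x = (\sum_a x a 0 * v a 0) / enorm x.
Proof.
move=> x0; rewrite deriveE; last exact: differentiable_enorm.
have s0 := sqnorm_gt0 x0.
rewrite (_ : @enorm R = @Num.sqrt R \o sqnorm) // diff_comp;
  [|exact: differentiable_sqnorm|exact: differentiable_sqrt].
rewrite [LHS]/= -(deriveE _ (differentiable_sqnorm x)).
(* The differential of the square root at a scalar is that scalar times its value at 1, the ordinary
   derivative. *)
rewrite -[X in 'd _ _ X]mulr1 [LHS]linearZ /= -(deriveE _ (differentiable_sqrt s0)).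
have [_ ->] := is_derive1_sqrt s0.
rewrite derive_sqnorm /GRing.scale /= -/(enorm x).
under eq_bigr do rewrite -mulrA.
by rewrite -mulr_sumr invfM mulrACA divff ?mul1r ?pnatr_eq0.
Qed.

Lemma differentiable_invnorm x : x != 0 -> differentiable (fun y => (enorm y)^-1) x.
Proof.
move=> x0; apply: differentiableV; first exact: differentiable_enorm.
by rewrite gt_eqF ?enorm_gt0.
Qed.

(** The result is a polynomial in the coordinates and the inverse norm, the shape that makes
    [radial_alg] closed under differentiation. *)
Lemma derive_invnorm x v : x != 0 ->
  'D_v (fun y => (enorm y)^-1) x = - (\sum_a x a 0 * v a 0) * (enorm x)^-1 ^+ 3.
Proof.
move=> x0; have e0 : enorm x != 0 by rewrite gt_eqF ?enorm_gt0.
rewrite deriveV //; last exact/diff_derivable/differentiable_enorm.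
rewrite derive_enorm // /GRing.scale /= -exprVn.
by rewrite (exprSr _ 2) mulNr -!mulrN; ring.
Qed.


End Calculus.

(** * The radial projection onto the sphere and functions built from it *)

Section RadialProjection.
Variables (R : realType) (r : R).
Implicit Types (x v : 'cV[R]_3) (h : 'cV[R]_3 -> R).

Definition radial x : 'cV[R]_3 := (r / enorm x) *: x.

Lemma differentiable_radial x : x != 0 -> differentiable radial x.
Proof.
move=> x0.
have -> : radial =
    \sum_(a < 3) (fun y : 'cV[R]_3 => (r * (enorm y)^-1 * y a 0) *: basis_vec R a).
  apply/funext => y; rewrite fct_sumE /=; apply/matrixP => i j.
  rewrite ord1 summxE (bigD1 i) //= big1 => [|k ki].
    by rewrite !mxE !eqxx mulr1 addr0.
  by rewrite !mxE eq_sym (negbTE ki) mulr0.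
apply: differentiable_sum => a; apply: differentiableZl.
apply: (@differentiableM _ _ (r *: (fun y => (enorm y)^-1)) (fun y : 'cV[R]_3 => y a 0)).
  exact/differentiableZ/differentiable_invnorm.
exact: differentiable_coord.
Qed.

Lemma derive_radial x v b : x != 0 -> ('D_v radial x) b 0 =
  r * ((enorm x)^-1 * v b 0
       - (\sum_a x a 0 * v a 0) * (enorm x)^-1 ^+ 3 * x b 0).
Proof.
move=> x0; rewrite derive_mx ?mxE; last exact/diff_derivable/differentiable_radial.
rewrite (_ : (fun t => _) =
  r *: ((fun y => (enorm y)^-1) * (fun y : 'cV[R]_3 => y b 0))); last first.
  by apply/funext => y; rewrite !mxE -mulrA.
have dn : derivable (fun y => (enorm y)^-1) x v.
  exact/diff_derivable/differentiable_invnorm.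
have dc : derivable (fun y : 'cV[R]_3 => y b 0) x v.
  exact/diff_derivable/differentiable_coord.
rewrite deriveZ; last exact: derivableM.
rewrite deriveM // derive_coord derive_invnorm // /GRing.scale /=.
ring.
Qed.

Lemma radial_sphere x : x != 0 -> 0 < r -> sphere r (radial x).
Proof.
move=> x0 r0; have e0 := enorm_gt0 x0.
rewrite /sphere /= {1}/enorm.
under eq_bigr do rewrite mxE exprMn.
rewrite -mulr_sumr sqrtrM ?sqr_ge0 // -/(enorm x) sqrtr_sqr.
by rewrite ger0_norm ?divr_ge0 ?ltW // divfK // gt_eqF.
Qed.

Lemma radial_id x : 0 < r -> sphere r x -> radial x = x.
Proof. by rewrite /radial => r0 ->; rewrite divff ?scale1r // gt_eqF. Qed.

(** [G] will be the set of real and imaginary parts of all iterated partials of a local smooth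
    extension, and [V] an open set away from the origin that [radial] sends into the domain of that
    extension. *)
Variables (V : set 'cV[R]_3) (G : set ('cV[R]_3 -> R)).

(* This algebra is stable under partial derivatives as soon as G is, so that its
   elements are smooth. *)
Inductive radial_alg : ('cV[R]_3 -> R) -> Prop :=
| Alg_comp g : G g -> radial_alg (g \o radial)
| Alg_coord (a : 'I_3) : radial_alg (fun x => x a 0)
| Alg_invnorm : radial_alg (fun x => (enorm x)^-1)
| Alg_cst c : radial_alg (cst c)
| Alg_add h k : radial_alg h -> radial_alg k -> radial_alg (h + k)
| Alg_mul h k : radial_alg h -> radial_alg k -> radial_alg (h * k).

Lemma radial_alg_sum n (F : 'I_n -> 'cV[R]_3 -> R) :
  (forall i, radial_alg (F i)) -> radial_alg (\sum_(i < n) F i).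
Proof.
by move=> FA; elim/big_ind : _ => //; [exact: Alg_cst|exact: Alg_add].
Qed.

Hypothesis V0 : forall x, V x -> x != 0.
Hypothesis Gdiff : forall g x, G g -> V x -> differentiable g (radial x).
Hypothesis Gpartial : forall g a, G g -> G (fun x => 'D_(basis_vec R a) g x).

Lemma radial_alg_differentiable h x : radial_alg h -> V x -> differentiable h x.
Proof.
move=> hA Vx; elim: hA => [g Gg|a||c|h1 h2 _ d1 _ d2|h1 h2 _ d1 _ d2].
- by apply: differentiable_comp; [exact/differentiable_radial/V0|exact: Gdiff].
- exact: differentiable_coord.
- exact/differentiable_invnorm/V0.
- exact: differentiable_cst.
- exact: differentiableD.
- exact: differentiableM.
Qed.

(** The chain rule brings in partials of g, which stay in [G], and entries of the Jacobian of
    [radial], which are polynomials in the coordinates and the inverse norm. Equality is claimed on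
    [V], where the norm does not vanish. *)
Lemma radial_alg_partial h a : radial_alg h ->
  exists2 h', radial_alg h' & forall x, V x -> 'D_(basis_vec R a) h x = h' x.
Proof.
have Edot x : \sum_b x b 0 * basis_vec R a b 0 = x a 0.
  rewrite (bigD1 a) //= big1 => [|b ba]; first by rewrite !mxE !eqxx mulr1 addr0.
  by rewrite !mxE (negbTE ba) mulr0.
move=> hA; elim: hA => [g Gg|b||c|h1 h2 A1 [k1 K1 E1] A2 [k2 K2 E2]
                       |h1 h2 A1 [k1 K1 E1] A2 [k2 K2 E2]].
- pose n x := (enorm x)^-1.
  (* The factor in front of the partial of g is component b of [derive_radial] along e_a, with the
     scalar product of x and e_a reduced to x_a. *)
  exists (\sum_b (cst r * (n * cst (basis_vec R a b 0)
      + cst (-1) * (fun x => x a 0) * (n * n * n) * (fun x => x b 0)))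
      * ((fun x => 'D_(basis_vec R b) g x) \o radial)).
    apply: radial_alg_sum => b; apply: Alg_mul; last exact/Alg_comp/Gpartial.
    do ?[apply: Alg_mul|apply: Alg_add|exact: Alg_cst|exact: Alg_invnorm
        |exact: Alg_coord].
  move=> x Vx; have x0 := V0 Vx; have dr := differentiable_radial x0.
  have dg := Gdiff Gg Vx.
  rewrite deriveE; last exact: differentiable_comp.
  rewrite diff_comp // [LHS]/= -(deriveE _ dr) -(deriveE _ dg) derive_basis //.
  rewrite fct_sumE; apply: eq_bigr => b _.
  rewrite derive_radial // Edot.
  by congr (_ * _); rewrite !fctE /n /=; ring.
- exists (cst (basis_vec R a b 0)); first exact: Alg_cst.
  by move=> x _; rewrite derive_coord.
- exists (cst (-1) * (fun x => x a 0) * ((fun x => (enorm x)^-1) *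
      (fun x => (enorm x)^-1) * (fun x => (enorm x)^-1))).
    do ?[apply: Alg_mul|exact: Alg_cst|exact: Alg_invnorm|exact: Alg_coord].
  move=> x Vx; rewrite derive_invnorm ?V0 // Edot !fctE /=; ring.
- by exists (cst 0); [exact: Alg_cst|move=> x _; rewrite derive_cst].
- exists (k1 + k2); first exact: Alg_add.
  move=> x Vx; rewrite deriveD ?E1 ?E2 //;
    exact/diff_derivable/radial_alg_differentiable.
- exists (h1 * k2 + h2 * k1); first by apply: Alg_add; exact: Alg_mul.
  move=> x Vx; rewrite deriveM ?E1 ?E2 //;
    exact/diff_derivable/radial_alg_differentiable.
Qed.

End RadialProjection.

(** * Smoothness of the extension that is constant along rays *)

Section Extension.
Variable R : realType.
Implicit Types (x : 'cV[R]_3) (f F : 'cV[R]_3 -> R[i]).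

(** On V, the real and imaginary parts of every iterated partial of f coincide with elements of
    [radial_alg], which are differentiable there. *)
Lemma radial_partials (r : R) (U V : set 'cV[R]_3) f F :
  0 < r -> open V -> (forall x, V x -> x != 0) ->
  (forall x, V x -> U (radial r x)) -> smooth_on U F ->
  (forall x, V x -> f x = F (radial r x)) -> smooth_on V f.
Proof.
move=> r0 oV V0 VU Fsm fF.
pose G := [set g | exists s, g = (fun y => complex.Re (partials s F y)) \/
                             g = (fun y => complex.Im (partials s F y))].
have Gd g x : G g -> V x -> differentiable g (radial r x).
  by move=> [s [] ->] Vx; have [] := Fsm s _ (VU _ Vx).
have Gp g a : G g -> G (fun x => 'D_(basis_vec R a) g x).
  by move=> [s [] ->]; exists (a :: s); [left|right].
have main s : (exists2 h, radial_alg r G h &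
                 forall x, V x -> complex.Re (partials s f x) = h x) /\
              (exists2 h, radial_alg r G h &
                 forall x, V x -> complex.Im (partials s f x) = h x).
  elim: s => [|a s [[h hA hE] [k kA kE]]].
    split; [exists ((fun y => complex.Re (F y)) \o radial r)
           |exists ((fun y => complex.Im (F y)) \o radial r)].
    + by apply: Alg_comp; exists [::]; left.
    + by move=> x Vx /=; rewrite fF.
    + by apply: Alg_comp; exists [::]; right.
    + by move=> x Vx /=; rewrite fF.
  (* As V is open, an equality on V holds near each of its points and can be differentiated. *)
  have near_V (p q : 'cV[R]_3 -> R) x : (forall x, V x -> p x = q x) -> V x ->
      \near x, p x = q x.
    move=> pq Vx; have : nbhs x V by exact: open_nbhs_nbhs.
    by apply: filterS.
  have [h' h'A h'E] := radial_alg_partial V0 Gd Gp a hA.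
  have [k' k'A k'E] := radial_alg_partial V0 Gd Gp a kA.
  split; [exists h' => // x Vx; rewrite -h'E //|exists k' => // x Vx; rewrite -k'E //].
  - exact/near_eq_derive/near_V.
  - exact/near_eq_derive/near_V.
move=> s x Vx; have nV : nbhs x V by exact: open_nbhs_nbhs.
have [[h hA hE] [k kA kE]] := main s.
split; [apply: near_eq_differentiable (radial_alg_differentiable V0 Gd hA Vx)
       |apply: near_eq_differentiable (radial_alg_differentiable V0 Gd kA Vx)];
  apply: filterS nV => y Vy; by rewrite ?hE ?kE.
Qed.

(** Smoothness of f composed with [radial] is local: near x it is the composite of [radial] with a
    smooth local extension of f around [radial r x]. *)
Lemma sphere_extension (r : R) f : 0 < r -> smooth_sphere r f ->
  exists F, smooth_on (@punctured_space R) F /\ forall x, sphere r x -> F x = f x.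
Proof.
move=> r0 fsm; exists (f \o radial r); split; last first.
  by move=> x xr /=; rewrite radial_id.
move=> s x x0.
have [U [F [oU Ux Fsm Ff]]] := fsm _ (radial_sphere x0 r0).
pose V := [set y | y != 0 /\ U (radial r y)].
have oV : open V.
  rewrite openE => y [y0 Uy]; rewrite /interior.
  have cr := differentiable_continuous (differentiable_radial r y0).
  have ce := differentiable_continuous (differentiable_enorm y0).
  have e0 : \near y, 0 < enorm y by exact: (cvgr_gt _ ce _ (enorm_gt0 y0)).
  have Ur : nbhs y (radial r @^-1` U) by apply: cr; exact: open_nbhs_nbhs.
  near=> z; split; last by near: z.
  (* Being nonzero is obtained from positivity of the norm, which persists nearby by continuity. *)
  have : 0 < enorm z by near: z.
  apply: contraTneq => ->; rewrite /enorm big1 ?sqrtr0 ?ltxx // => a _.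
  by rewrite mxE expr0n.
suff : smooth_on V (f \o radial r) by apply; split.
apply: (radial_partials r0 oV _ _ Fsm) => y [y0 Uy] //.
by rewrite /= Ff //; exact: radial_sphere.
Unshelve. all: by end_near. Qed.

(** Since an extension exists, the choice in [extension] does not fall back on its default 0. *)
Lemma extensionP (r : R) f : 0 < r -> smooth_sphere r f ->
  smooth_on (@punctured_space R) (extension r f) /\
  forall x, sphere r x -> extension r f x = f x.
Proof. by move=> r0 /(sphere_extension r0)/(@xgetPex _ (cst 0)). Qed.

End Extension.

(** * Complexified left invariant vector fields *)

Section MatrixCurves.
Variables (R : realType).

Lemma is_derive_mxP m n (M : R -> 'M[R]_(m, n)) (t v : R) d :
  is_derive t v M d <->
  forall i j, is_derive t v (fun u => M u i j) (d i j).
Proof.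
split=> [[Md <-] i j|Md].
  have Mij := (derivable_mxP _ _ _).1 Md i j.
  by split; rewrite // derive_mx // mxE.
have dM : derivable M t v.
  by apply/derivable_mxP => i j; have [] := Md i j.
split; rewrite // derive_mx //; apply/matrixP => i j; rewrite mxE.
by have [_ ->] := Md i j.
Qed.

Lemma is_derive_mulmx m n p (A : 'M[R]_(m, n)) (M : R -> 'M[R]_(n, p)) (t v : R) d :
  is_derive t v M d -> is_derive t v (fun u => A *m M u) (A *m d).
Proof.
move=> /is_derive_mxP Md; apply/is_derive_mxP => i j.
rewrite (_ : (fun u => _) = \sum_(k < n) (A i k *: (fun u => M u k j))).
  rewrite mxE; apply: is_derive_sum => k; exact: is_deriveZ.
by apply/funext => u; rewrite mxE fct_sumE.
Qed.

Lemma is_derive_opp m n (M : R -> 'M[R]_(m, n)) d :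
  is_derive (0 : R) (1 : R) M d ->
  is_derive (0 : R) (1 : R) (fun t => M (- t)) (- d).
Proof.
move=> /is_derive_mxP Md; apply/is_derive_mxP => i j; rewrite mxE.
have Mij : is_derive (- 0 : R) (1 : R) (fun u => M u i j) (d i j).
  by rewrite oppr0.
have N1 : is_derive (0 : R) (1 : R) -%R (-1) by exact: is_deriveNid.
by have := is_derive1_comp Mij N1; rewrite mulrN1.
Qed.

Lemma is_derive_comp_grad (h : 'cV[R]_3 -> R) (c : R -> 'cV[R]_3) (t : R) x d :
  c t = x -> is_derive t (1 : R) c d -> differentiable h x ->
  is_derive t (1 : R) (fun u => h (c u)) (\sum_b d b 0 * 'D_(basis_vec R b) h x).
Proof.
move=> <- [/derivable1_diffP dc <-] dh.
have dhc : differentiable (h \o c) t by exact: differentiable_comp.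
split; first exact/derivable1_diffP.
rewrite -derive_basis // -[X in 'D__ X _ = _]/(h \o c) deriveE // diff_comp //.
by rewrite [LHS]/= -(deriveE _ dc) -deriveE.
Qed.

End MatrixCurves.

(** * Derivation rules for left invariant vector fields *)

Section ComplexifiedVectorFields.
Variable R : realType.
Local Notation C := R[i].
Implicit Types (X Y a b : 'M[C]_2) (F G : 'M[C]_2 -> C) (d e : C).

(** Derivability is part of the predicate, unlike a bare value of [derive1], so that sum and product
    rules are available. *)
Definition is_cderive (h : R -> C) d :=
  is_derive (0 : R) (1 : R) (fun t => complex.Re (h t)) (complex.Re d) /\
  is_derive (0 : R) (1 : R) (fun t => complex.Im (h t)) (complex.Im d).

Lemma is_cderive_cst d : is_cderive (cst d) 0.
Proof. by split; exact: is_derive_cst. Qed.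

Lemma is_cderiveD h k d e : is_cderive h d -> is_cderive k e ->
  is_cderive (fun t => h t + k t) (d + e).
Proof.
move=> [hr hi] [kr ki]; split; rewrite raddfD /=.
- rewrite (_ : (fun t => _) =
    (fun t => complex.Re (h t)) + (fun t => complex.Re (k t))).
    exact: is_deriveD.
  by apply/funext => t; rewrite raddfD.
- rewrite (_ : (fun t => _) =
    (fun t => complex.Im (h t)) + (fun t => complex.Im (k t))).
    exact: is_deriveD.
  by apply/funext => t; rewrite raddfD.
Qed.

Lemma ReM (x y : C) : complex.Re (x * y) =
  complex.Re x * complex.Re y - complex.Im x * complex.Im y.
Proof. by case: x y => [? ?] [? ?]. Qed.

Lemma ImM (x y : C) : complex.Im (x * y) =
  complex.Re x * complex.Im y + complex.Im x * complex.Re y.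
Proof. by case: x y => [? ?] [? ?]. Qed.

Lemma is_cderiveM h k d e : is_cderive h d -> is_cderive k e ->
  is_cderive (fun t => h t * k t) (d * k 0 + h 0 * e).
Proof.
move=> [hr hi] [kr ki]; split; rewrite raddfD /= ?ReM ?ImM.
- rewrite (_ : (fun t => _) =
    (fun t => complex.Re (h t)) * (fun t => complex.Re (k t)) -
    (fun t => complex.Im (h t)) * (fun t => complex.Im (k t))).
    apply: is_derive_eq (is_deriveB (is_deriveM hr kr) (is_deriveM hi ki)) _.
    by rewrite /GRing.scale /=; ring.
  by apply/funext => t; rewrite ReM.
- rewrite (_ : (fun t => _) =
    (fun t => complex.Re (h t)) * (fun t => complex.Im (k t)) +
    (fun t => complex.Im (h t)) * (fun t => complex.Re (k t))).
    apply: is_derive_eq (is_deriveD (is_deriveM hr ki) (is_deriveM hi kr)) _.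
    by rewrite /GRing.scale /=; ring.
  by apply/funext => t; rewrite ImM.
Qed.

(** A relational form of [left_invC], which also asserts that the derivatives along X and Y
    exist. *)
Definition is_left_invC X Y F a d :=
  exists d1 d2, [/\ is_cderive (fun t => F (a *m expmx (t%:C *: X))) d1,
                    is_cderive (fun t => F (a *m expmx (t%:C *: Y))) d2 &
                    d = d1 + (0 +i* 1) * d2].

Lemma left_invE X F a d :
  is_cderive (fun t => F (a *m expmx (t%:C *: X))) d -> left_inv X F a = d.
Proof.
case: d => dr di [[_ Hr] [_ Hi]]; rewrite /left_inv.
by congr (_ +i* _); rewrite derive1E; [exact: Hr|exact: Hi].
Qed.

Lemma left_invCE X Y F a d : is_left_invC X Y F a d -> left_invC X Y F a = d.
Proof.
by move=> [d1 [d2 [/left_invE dX /left_invE dY ->]]]; rewrite /left_invC dX dY.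
Qed.

Lemma expmx0 : expmx (0 : 'M[C]_2) = 1%:M.
Proof.
apply: cvg_lim => //; apply: cvg_near_cst; near=> n.
have n0 : (0 < n)%N by near: n; exact: nbhs_infty_gt.
rewrite /series /= big_ltn // expr0 fact0 invr1 scale1r big_nat big1 ?addr0 //.
by move=> k /andP[k0 _]; rewrite expr0n gtn_eqF // scaler0.
Unshelve. all: by end_near. Qed.

Lemma is_left_invC_cst X Y a d : is_left_invC X Y (cst d) a 0.
Proof.
by exists 0, 0; split; [exact: is_cderive_cst|exact: is_cderive_cst|rewrite mulr0 addr0].
Qed.

Lemma is_left_invCD X Y F G a d e :
  is_left_invC X Y F a d -> is_left_invC X Y G a e ->
  is_left_invC X Y (fun b => F b + G b) a (d + e).
Proof.
move=> [d1 [d2 [dX dY ->]]] [e1 [e2 [eX eY ->]]].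
exists (d1 + e1), (d2 + e2); split; last by ring.
- exact: (is_cderiveD dX eX).
- exact: (is_cderiveD dY eY).
Qed.

Lemma is_left_invCM X Y F G a d e :
  is_left_invC X Y F a d -> is_left_invC X Y G a e ->
  is_left_invC X Y (fun b => F b * G b) a (d * G a + F a * e).
Proof.
move=> [d1 [d2 [dX dY ->]]] [e1 [e2 [eX eY ->]]].
exists (d1 * G a + F a * e1), (d2 * G a + F a * e2); split; last by ring.
- by have := is_cderiveM dX eX; rewrite scale0r expmx0 mulmx1.
- by have := is_cderiveM dY eY; rewrite scale0r expmx0 mulmx1.
Qed.

Lemma is_left_invC_sum (I : Type) (s : seq I) X Y (F : I -> 'M[C]_2 -> C) a (d : I -> C) :
  (forall i, is_left_invC X Y (F i) a (d i)) ->
  is_left_invC X Y (fun b => \sum_(i <- s) F i b) a (\sum_(i <- s) d i).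
Proof.
move=> Fd; elim: s => [|i s IHs].
  by under eq_fun do rewrite big_nil; rewrite big_nil; exact: is_left_invC_cst.
under eq_fun do rewrite big_cons; rewrite big_cons.
exact: is_left_invCD.
Qed.

(** By the Leibniz rule; it will apply to the coefficients of the iterated partials. *)
Lemma is_left_invC_prod0 (I : Type) (s : seq I) X Y (F : I -> 'M[C]_2 -> C) a :
  (forall i, is_left_invC X Y (F i) a 0) ->
  is_left_invC X Y (fun b => \prod_(i <- s) F i b) a 0.
Proof.
move=> F0; elim: s => [|i s IHs].
  by under eq_fun do rewrite big_nil; exact: is_left_invC_cst.
under eq_fun do rewrite big_cons.
by have := is_left_invCM (F0 i) IHs; rewrite mul0r mulr0 addr0.
Qed.

Lemma SU2M a b : SU2 a -> SU2 b -> SU2 (a *m b).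
Proof.
move=> [aU da] [bU db]; split; first exact: mul_unitarymx.
by rewrite det_mulmx da db mulr1.
Qed.

Lemma su2Z (t : R) X : su2 X -> su2 (t%:C *: X).
Proof.
move=> [XH Xtr]; split; last by rewrite mxtraceZ Xtr mulr0.
apply/matrixP => i j; have /matrixP/(_ i j) := XH; rewrite !mxE => XE.
rewrite rmorphM /= XE mulrN; congr (- (_ * _)).
by apply: conj_Creal; rewrite complex_real.
Qed.

(** The curves a exp(tX) and a exp(tY) stay in SU(2), so the derivatives see only values there. *)
Lemma eq_is_left_invC X Y F G a d : su2 X -> su2 Y -> SU2 a ->
  (forall b, SU2 b -> F b = G b) ->
  is_left_invC X Y F a d -> is_left_invC X Y G a d.
Proof.
move=> sX sY sa FG [d1 [d2 [dX dY dE]]].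
have E Z : su2 Z -> (fun t : R => G (a *m expmx (t%:C *: Z))) =
                    (fun t : R => F (a *m expmx (t%:C *: Z))).
  move=> sZ; apply/funext => t; rewrite FG //; apply: SU2M => //.
  exact/expmx_SU2/su2Z.
by exists d1, d2; split; rewrite ?E.
Qed.

Lemma is_cderive_real (u v : R -> R) du dv :
  is_derive (0 : R) (1 : R) u du -> is_derive (0 : R) (1 : R) v dv ->
  is_cderive (fun t => u t +i* v t) (du +i* dv).
Proof. by []. Qed.

End ComplexifiedVectorFields.

(** * Iterated derivatives of lifts *)

(** The summand is a function on sequences, so that one expression makes sense for both lengths. *)
Lemma sum_tupleS (V : nmodType) (I : finType) n (F : seq I -> V) :
  \sum_(s : n.+1.-tuple I) F s = \sum_(i : I) \sum_(s : n.-tuple I) F (i :: s).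
Proof.
rewrite pair_bigA /=.
rewrite (reindex (fun p : I * n.-tuple I => [tuple of p.1 :: p.2])) //=.
exists (fun s : n.+1.-tuple I => (thead s, [tuple of behead s])).
- by move=> [i s] _ /=; rewrite theadE; congr pair; apply: val_inj.
- by move=> s _; rewrite /= [RHS]tuple_eta; apply: val_inj.
Qed.

Lemma cross_basis (R : realType) (a b : 'I_3) :
  cross (basis_vec R a) (basis_vec R b) = \col_c levi_civita R a b c.
Proof.
apply/matrixP => c z; rewrite !mxE (bigD1 a) //= [X in _ + X]big1 => [|i ia].
  rewrite addr0 (bigD1 b) //= big1 => [|j jb]; rewrite !mxE ?eqxx ?mulr1 ?addr0 //.
  by rewrite (negbTE jb) mulr0.
by rewrite big1 // => j _; rewrite !mxE (negbTE ia) mulr0 mul0r.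
Qed.

Section Lifts.
Variables (R : realType) (r : R) (rho : 'M[R[i]]_2 -> 'M[R]_3).
(** The sign [sigma] treats both fields at once: 1 with Y = [L 1] gives [Lplus], and -1 with Y =
    [- L 1] gives [Lminus]. *)
Variables (X Y : 'M[R[i]]_2) (sigma : R).
Local Notation C := R[i].
Implicit Types (a : 'M[C]_2) (b : 'I_3) (x : 'cV[R]_3) (f F : 'cV[R]_3 -> C).

Hypothesis r_gt0 : 0 < r.
Hypothesis rho_SO3 : forall a, SU2 a -> SO3 (rho a).
Hypothesis rhoM : forall a a', SU2 a -> SU2 a' -> rho (a *m a') = rho a *m rho a'.
Hypotheses (su2X : su2 X) (su2Y : su2 Y) (sigma2 : sigma ^+ 2 = 1).
Hypothesis dX : forall x,
  is_derive (0 : R) (1 : R) (fun t : R => rho (expmx (t%:C *: X)) *m x)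
    (cross x (basis_vec R 0)).
Hypothesis dY : forall x,
  is_derive (0 : R) (1 : R) (fun t : R => rho (expmx (t%:C *: Y)) *m x)
    (sigma *: cross x (basis_vec R 1)).

(* The derivative of the orbit map along X + iY. It is -i sigma r times the
   image of e_1 + i sigma e_2, a vector killed by x |-> x * (e_1 + i sigma e_2):
   this is why iterating X + iY produces no lower order terms. *)
Definition null_vec a (b : 'I_3) : C :=
  (r * rho a b 1) +i* (- sigma * (r * rho a b 0)).

Let SU2exp (t : R) Z : su2 Z -> SU2 (expmx (t%:C *: Z)).
Proof. by move=> sZ; exact/expmx_SU2/su2Z. Qed.

Lemma is_derive_rho a Z x d : SU2 a -> su2 Z ->
  is_derive (0 : R) (1 : R) (fun t : R => rho (expmx (t%:C *: Z)) *m x) d ->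
  is_derive (0 : R) (1 : R) (fun t : R => rho (a *m expmx (t%:C *: Z)) *m x)
    (rho a *m d).
Proof.
move=> sa sZ /(is_derive_mulmx (rho a)) dZ.
under eq_fun do rewrite (rhoM sa (SU2exp _ sZ)) -mulmxA.
exact: dZ.
Qed.

Lemma mulmx_basis_vec (A : 'M[R]_3) b j : (A *m basis_vec R j) b 0 = A b j.
Proof. by rewrite /basis_vec -colE mxE. Qed.

Lemma is_derive_rho_coord a Z b j d : SU2 a -> su2 Z ->
  is_derive (0 : R) (1 : R)
    (fun t : R => rho (expmx (t%:C *: Z)) *m basis_vec R j) d ->
  is_derive (0 : R) (1 : R) (fun t : R => rho (a *m expmx (t%:C *: Z)) b j)
    ((rho a *m d) b 0).
Proof.
move=> sa sZ /(is_derive_rho sa sZ)/is_derive_mxP/(_ b 0).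
by under eq_fun do rewrite mulmx_basis_vec.
Qed.

Let crossE : ((cross (basis_vec R 0) (basis_vec R 0) = 0)
  * (cross (basis_vec R 1) (basis_vec R 0) = - basis_vec R 2)
  * (cross (basis_vec R 2) (basis_vec R 0) = basis_vec R 1)
  * (cross (basis_vec R 0) (basis_vec R 1) = basis_vec R 2)
  * (cross (basis_vec R 1) (basis_vec R 1) = 0)
  * (cross (basis_vec R 2) (basis_vec R 1) = - basis_vec R 0))%type.
Proof.
do !split; apply/matrixP => c z; rewrite cross_basis ord1 !mxE;
  by elim/ord3_ind: c; rewrite /levi_civita /= ?oppr0.
Qed.

(** With c_j the columns of [rho a], the field X sends c_1 to -c_2 and c_0 to 0, while Y sends c_0
    to sigma c_2 and c_1 to 0. The total is -r c_2 + sigma^2 r c_2 = 0. *)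
Lemma null_vec_is_left_invC a b : SU2 a ->
  is_left_invC X Y (null_vec ^~ b) a 0.
Proof.
move=> sa.
have X1 := is_derive_rho_coord b sa su2X (dX (basis_vec R 1)).
have X0 := is_derive_rho_coord b sa su2X (dX (basis_vec R 0)).
have Y1 := is_derive_rho_coord b sa su2Y (dY (basis_vec R 1)).
have Y0 := is_derive_rho_coord b sa su2Y (dY (basis_vec R 0)).
have c0 : (rho a *m (0 : 'cV[R]_3)) b 0 = 0 by rewrite mulmx0 mxE.
have cN v : (rho a *m - v) b 0 = - (rho a *m v) b 0 by rewrite mulmxN mxE.
have cZ v : (rho a *m (sigma *: v)) b 0 = sigma * (rho a *m v) b 0.
  by rewrite -scalemxAr mxE.
move: X1 X0 Y1 Y0; rewrite !crossE scaler0 cN cZ c0 !mulmx_basis_vec => X1 X0 Y1 Y0.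
exists ((r * - rho a b 2) +i* (- sigma * (r * 0))).
exists ((r * 0) +i* (- sigma * (r * (sigma * rho a b 2)))); split.
- by apply: is_cderive_real; do ?apply: is_deriveZ.
- by apply: is_cderive_real; do ?apply: is_deriveZ.
- apply/eqP; rewrite eq_complex /=; apply/andP; split; apply/eqP; last by ring.
  by ring: sigma2.
Qed.

(** By the chain rule: the orbit point moves by r c_1 along X and by -sigma r c_0 along Y, where c_j
    are the columns of [rho a]; these combine to [null_vec a]. *)
Lemma smooth_is_left_invC F a : SU2 a ->
  differentiable (fun x => complex.Re (F x)) (orbit_map r rho a) ->
  differentiable (fun x => complex.Im (F x)) (orbit_map r rho a) ->
  is_left_invC X Y (fun a => F (orbit_map r rho a)) a
    (\sum_b null_vec a b * partial b F (orbit_map r rho a)).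
Proof.
move=> sa dRe dIm; set x := orbit_map r rho a in dRe dIm *.
have dir Z d : su2 Z ->
    is_derive (0 : R) (1 : R)
      (fun t : R => rho (expmx (t%:C *: Z)) *m (r *: basis_vec R 2)) d ->
    is_cderive (fun t => F (orbit_map r rho (a *m expmx (t%:C *: Z))))
      (\sum_b ((rho a *m d) b 0)%:C * partial b F x).
  move=> sZ /(is_derive_rho sa sZ) dZ.
  have c0 : rho (a *m expmx ((0 : R)%:C *: Z)) *m (r *: basis_vec R 2) = x.
    by rewrite scale0r expmx0 mulmx1.
  split.
  - apply: is_derive_eq (is_derive_comp_grad c0 dZ dRe) _.
    by rewrite raddf_sum; apply: eq_bigr => b _; rewrite [RHS]ReM /= mul0r subr0.
  - apply: is_derive_eq (is_derive_comp_grad c0 dZ dIm) _.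
    by rewrite raddf_sum; apply: eq_bigr => b _; rewrite [RHS]ImM /= mul0r addr0.
have crossZ (s : R) (u v : 'cV[R]_3) : cross (s *: u) v = s *: cross u v.
  apply/matrixP => c z; rewrite !mxE mulr_sumr; apply: eq_bigr => i _.
  rewrite mulr_sumr; apply: eq_bigr => j _; rewrite !mxE; ring.
have := dir _ _ su2X (dX _); have := dir _ _ su2Y (dY _).
rewrite !crossZ !crossE => cY cX.
do 2 eexists; split; [exact: cX|exact: cY|].
rewrite mulr_sumr -big_split; apply: eq_bigr => b _ /=.
rewrite mulrA -mulrDl; congr (_ * _).
have cZ t v : (rho a *m (t *: v)) b 0 = t * (rho a *m v) b 0.
  by rewrite -scalemxAr mxE.
have cN v : (rho a *m - v) b 0 = - (rho a *m v) b 0 by rewrite mulmxN mxE.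
rewrite !cZ cN !mulmx_basis_vec.
by apply/eqP; rewrite eq_complex /=; apply/andP; split; apply/eqP; ring.
Qed.

(** Induction on n: the product of null vector components is killed, so the field differentiates
    only the partial of F, adding one index and one component. *)
Lemma iter_left_invC f F : (forall x, sphere r x -> F x = f x) ->
  smooth_on (@punctured_space R) F -> forall n a, SU2 a ->
  iter n (left_invC X Y) (Defs.lift r rho f) a =
  \sum_(s : n.-tuple 'I_3)
    (\prod_(b <- s) null_vec a b) * partials s F (orbit_map r rho a).
Proof.
move=> Ff Fsm; have orb_sphere a : SU2 a -> sphere r (orbit_map r rho a).
  move=> /rho_SO3 sa; rewrite /sphere /= SO3_enorm // enorm_basis_vec //.
  exact: ltW.
have orb0 a : SU2 a -> orbit_map r rho a != 0.
  move=> /orb_sphere; apply: contra_eqN => /eqP ->.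
  by rewrite /enorm big1 ?sqrtr0 ?lt_eqF // => i _; rewrite mxE expr0n.
elim=> [|n IHn] a sa /=.
  rewrite (big_pred1 [tuple]) => [|s]; last exact/esym/eqP/tuple0.
  by rewrite big_nil mul1r /Defs.lift /= Ff //; exact: orb_sphere.
rewrite (sum_tupleS _ (fun s => (\prod_(b <- s) null_vec a b)
                        * partials s F (orbit_map r rho a))).
apply: left_invCE.
(* The induction hypothesis is known on SU(2) only, which suffices for differentiating it. *)
apply: (@eq_is_left_invC _ _ _ (fun a => \sum_(s : n.-tuple 'I_3)
    (\prod_(b <- s) null_vec a b) * partials s F (orbit_map r rho a))) => //.
  by move=> a' sa'; rewrite IHn.
(* The new index, at the head of the sequence, becomes the inner sum, as in the chain rule for a
   fixed s. *)
rewrite exchange_big /=; apply: is_left_invC_sum => s.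
have sd := Fsm s _ (orb0 _ sa).
have w0 := is_left_invC_prod0 s (fun b => null_vec_is_left_invC b sa).
have := is_left_invCM w0 (smooth_is_left_invC sa sd.1 sd.2).
rewrite mul0r add0r mulr_sumr; congr (is_left_invC _ _ _ _ _).
by apply: eq_bigr => b _; rewrite big_cons mulrCA mulrA.
Qed.

End Lifts.

(** * Term by term comparison of the two products *)

Theorem proposition1 (R : realType) (r : R) (L : 'I_3 -> 'M[R[i]]_2)
    (rho : 'M[R[i]]_2 -> 'M[R]_3) (f g : 'cV[R]_3 -> R[i]) :
  0 < r ->
  su2_basis L ->
  double_cover rho ->
  differential_cross L rho ->
  smooth_sphere r f ->
  smooth_sphere r g ->
  forall (k : nat) (x : 'cV[R]_3), sphere r x ->
    diamond r L rho f g k x = star_sphere r f g k x.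
Proof.
move=> r0 [su2L _ _] [[_ rho_SO3] rhoM rho_onto _] drho fsm gsm k x xr.
have [fF Ff] := extensionP r0 fsm; have [gG Gg] := extensionP r0 gsm.
rewrite /diamond /descend /star_sphere /star xr.
(* [descend] evaluates at a chosen preimage of x. One exists by transitivity of rotations and
   surjectivity of [rho], so the default 1 is not a fallback; the rest holds for any preimage a. *)
have [sa ax] : [set a | SU2 a /\ orbit_map r rho a = x]
    (xget 1%:M [set a | SU2 a /\ orbit_map r rho a = x]).
  apply: (@xgetPex _ 1%:M); have [A SA Ax] := SO3_transitive r0 xr.
  by have [b sb bA] := rho_onto _ SA; exists b; split; rewrite // /orbit_map bA.
move: (xget _ _) sa ax => a sa ax.
have dXL v : is_derive (0 : R) (1 : R)
    (fun t : R => rho (expmx (t%:C *: L 0)) *m v) (cross v (basis_vec R 0)).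
  exact: drho.
have dYL v : is_derive (0 : R) (1 : R)
    (fun t : R => rho (expmx (t%:C *: L 1)) *m v) (1 *: cross v (basis_vec R 1)).
  by rewrite scale1r; exact: drho.
have ZN (t : R) : t%:C *: - L 1 = (- t)%:C *: L 1.
  by rewrite scalerN -scaleNr -rmorphN.
(* The curve of [- L 1] is that of [L 1] run backwards, whence sigma = -1. *)
have dNL v : is_derive (0 : R) (1 : R)
    (fun t : R => rho (expmx (t%:C *: - L 1)) *m v) (-1 *: cross v (basis_vec R 1)).
  have -> : (fun t : R => rho (expmx (t%:C *: - L 1)) *m v) =
            (fun t : R => rho (expmx ((- t)%:C *: L 1)) *m v).
    by apply/funext => t; rewrite (ZN t).
  by rewrite scaleN1r; exact: (is_derive_opp (drho 1 v)).
have su2N : su2 (- L 1).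
  by have := su2Z (-1) (su2L 1); rewrite rmorphN rmorph1 scaleN1r.
have N1 : (-1 : R) ^+ 2 = 1 by rewrite sqrrN expr1n.
have P1 : (1 : R) ^+ 2 = 1 by rewrite expr1n.
(* Both series have the coefficients C_n(hbar / r), so it suffices to compare the terms they
   multiply. *)
rewrite /diamond_lift; congr hbar_series; apply/funext => -[|n].
  by rewrite /Defs.lift ax Ff // Gg.
have := iter_left_invC r0 rho_SO3 rhoM (su2L 0) su2N N1 dXL dNL Ff fF n.+1 sa.
rewrite -[left_invC (L 0) (- L 1)]/(Lminus L) => EF.
have := iter_left_invC r0 rho_SO3 rhoM (su2L 0) (su2L 1) P1 dXL dYL Gg gG n.+1 sa.
rewrite -[left_invC (L 0) (L 1)]/(Lplus L) => EG.
apply: (eq_trans (congr2 *%R EF EG)).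
(* The product of the two sums over tuples becomes the double sum of [star_term]; regrouped by
   position j, each pair of components of the two null vectors is an entry of J. *)
rewrite ax big_distrlr /=; apply: eq_bigr => s _; apply: eq_bigr => t _.
rewrite mulrACA -[RHS]mulrA; congr (_ * _); rewrite !big_tuple -big_split.
apply: eq_bigr => j _; rewrite -ax SO3_Jtensor //; last exact: rho_SO3.
by rewrite /null_vec opprK mul1r mulN1r.
Qed.
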